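(* Let $R$ be a euclidean ring, let $n\geq 6$ and let $\Gamma=SL_n(R)$. Then every quasi-homomorphism $\psi\colon\Gamma\to\mathbb{R}$ is bounded. Equivalently, the stable commutator length vanishes identically on $[\Gamma,\Gamma]$.
   Context: A euclidean ring is a commutative integral domain with unit admitting a euclidean function (division with remainder). $SL_n(R)$ is the group of $n\times n$ matrices over $R$ of determinant $1$. A quasi-homomorphism on a group $\Gamma$ is a function $\psi\colon\Gamma\to\mathbb{R}$ with $\sup_{g,h\in\Gamma}|\psi(gh)-\psi(g)-\psi(h)|<\infty$. For $g\in[\Gamma,\Gamma]$, $\mathrm{cl}(g)$ is the least number of commutators whose product is $g$ ($\mathrm{cl}(e)=0$), and the stable commutator length is $\mathrm{scl}(g)=\lim_{k\to\infty}\mathrm{cl}(g^k)/k$. *)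

(* Defs.v *)
From HB Require Import structures.
From mathcomp Require Import all_boot all_order all_algebra.
From mathcomp Require Import all_classical all_reals all_analysis.
Set Implicit Arguments. Unset Strict Implicit. Unset Printing Implicit Defensive.
Import Order.TTheory GRing.Theory Num.Theory numFieldNormedType.Exports.
Local Open Scope ring_scope.
Local Open Scope classical_set_scope.

Definition euclidean_ring (R : idomainType) : Prop :=
  exists phi : R -> nat, forall a b : R, b != 0 ->
    exists q r : R, a = q * b + r /\ (r = 0 \/ (phi r < phi b)%N).

Definition inSL (R : idomainType) (n : nat) (A : 'M[R]_n) : Prop := \det A = 1.

(* psi : SL_n(R) -> K is a quasi-homomorphism (values off SL_n are irrelevant) *)
Definition quasi_hom_SL (R : idomainType) (n : nat) (K : realType)
  (psi : 'M[R]_n -> K) : Prop :=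
  exists D : K, forall A B : 'M[R]_n, inSL A -> inSL B ->
    `|psi (A *m B) - psi A - psi B| <= D.

Definition bounded_on_SL (R : idomainType) (n : nat) (K : realType)
  (psi : 'M[R]_n -> K) : Prop :=
  exists C : K, forall A : 'M[R]_n, inSL A -> `|psi A| <= C.

Definition mxcomm (R : idomainType) (n : nat) (A B : 'M[R]_n) : 'M[R]_n :=
  invmx A *m invmx B *m A *m B.

Definition prod_comm (R : idomainType) (n : nat) (k : nat) (g : 'M[R]_n) : Prop :=
  exists s : seq ('M[R]_n * 'M[R]_n),
    size s = k /\ all (fun p => `[< inSL p.1 >] && `[< inSL p.2 >]) s /\
    g = foldr (fun p acc => mxcomm p.1 p.2 *m acc) 1%:M s.

Definition in_comm_subgroup (R : idomainType) (n : nat) (g : 'M[R]_n) : Prop :=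
  exists k, prod_comm k g.

(* commutator length (0 outside [Gamma,Gamma], irrelevant there) *)
Definition cl (R : idomainType) (n : nat) (g : 'M[R]_n) : nat :=
  match pselect (exists k, (fun k => `[< prod_comm k g >]) k) with
  | left h => ex_minn h
  | right _ => 0%N
  end.

Definition mxpow (R : idomainType) (n : nat) (g : 'M[R]_n) (k : nat) : 'M[R]_n :=
  iter k (mulmx g) 1%:M.

Definition scl_zero (R : idomainType) (n : nat) (K : realType) (g : 'M[R]_n) : Prop :=
  (fun k : nat => ((cl (mxpow g k))%:R / k%:R : K)) @ \oo --> (0 : K).

(* Main.v *)
Require Import Defs.
From HB Require Import structures.
From mathcomp Require Import all_boot all_order all_algebra.
From mathcomp Require Import all_classical all_reals all_analysis.
From mathcomp Require Import fingroup perm ring lra zify.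
Import Order.TTheory GRing.Theory Num.Theory numFieldNormedType.Exports.
Local Open Scope ring_scope.
Set Implicit Arguments.
Unset Strict Implicit.
Unset Printing Implicit Defensive.

(* Call [A] in [SL_n(R)] bounded when the commutator length of [A^k] is bounded
   in [k].  Boundedness is invariant under conjugation, and a block triangular
   matrix is bounded iff its diagonal part is, since a block unipotent of
   [SL_4] is a single commutator.

   For [A = [p q; r s]] in [SL_2(R)], consider the [R[t]]-module [R^2] on which
   [t] acts by [A].  The quotient by [<e_1, A e_1>] is [R/r] with [t] acting by
   [s], and [A] restricts to a companion-like matrix on the submodule, which is
   conjugate to its inverse and therefore bounded.  Comparing two such
   presentations of [(R/r, s)] through their pullback, a module of rank 4, shows
   that boundedness of [diag(A, 1)] depends only on [r] and [s mod r].  It is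
   thus invariant under [A -> A E_12(m)], hence under [A -> A E_21(m)], and
   since [SL_2(R)] is generated by elementary matrices every [diag(A, 1)] is
   bounded.

   Gaussian elimination writes every element of [SL_n(R)] as a product of a
   fixed number [N] of conjugates of such matrices, so that the commutator
   length of [g^j] is at most [N j + O_g(1)], with [N] independent of [g].
   This bounds a quasi-homomorphism uniformly, and applied to [g^k] for all [k]
   it gives [scl g <= N / k]. *)

(** * Products of commutators in [SL_n(R)] *)

Lemma mxpowE (R : idomainType) (n : nat) (A : 'M[R]_n.+1) k : mxpow A k = A ^+ k.
Proof. by elim: k => [|k IH] //; rewrite exprS -IH. Qed.

Lemma inSL1 (R : idomainType) (n : nat) : inSL (1%:M : 'M[R]_n).
Proof. exact: det1. Qed.
#[local] Hint Resolve inSL1 : core.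

Lemma inSLM (R : idomainType) (n : nat) (A B : 'M[R]_n) :
  inSL A -> inSL B -> inSL (A *m B).
Proof. by rewrite /inSL det_mulmx => -> ->; rewrite mulr1. Qed.

Lemma inSLV (R : idomainType) (n : nat) (A : 'M[R]_n.+1) : inSL A -> inSL A^-1.
Proof. by rewrite /inSL det_inv => ->; rewrite invr1. Qed.

Lemma inSL_unit (R : idomainType) (n : nat) (A : 'M[R]_n.+1) :
  inSL A -> A \is a GRing.unit.
Proof. by rewrite /inSL -[_ \is a _]/(A \in unitmx) unitmxE => ->; exact: unitr1. Qed.

Lemma inSLX (R : idomainType) (n : nat) (A : 'M[R]_n.+1) k :
  inSL A -> inSL (A ^+ k).
Proof.
move=> sA; elim: k => [|k IH]; first exact: inSL1.
by rewrite exprS; apply: inSLM.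
Qed.

Lemma inSL_conj (R : idomainType) (n : nat) (x A : 'M[R]_n.+1) :
  x \is a GRing.unit -> inSL A -> inSL (x * A * x^-1).
Proof.
move=> ux; rewrite /inSL !det_mulmx det_inv => ->.
by rewrite mulr1 divrr // -unitmxE.
Qed.

Lemma conjr_exp (R : unitRingType) (x a : R) k :
  x \is a GRing.unit -> (x * a * x^-1) ^+ k = x * a ^+ k * x^-1.
Proof.
move=> ux; elim: k => [|k IH]; first by rewrite !expr0 mulr1 divrr.
by rewrite !exprS IH !mulrA mulrVK.
Qed.

Lemma mxcommE (R : idomainType) (n : nat) (A B : 'M[R]_n.+1) :
  mxcomm A B = A^-1 * B^-1 * A * B.
Proof. by []. Qed.

Lemma mxcomm_inSL (R : idomainType) (n : nat) (A B : 'M[R]_n.+1) :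
  inSL A -> inSL B -> inSL (mxcomm A B).
Proof. by move=> sA sB; rewrite mxcommE; do !apply: inSLM => //; apply: inSLV. Qed.

Lemma prod_comm0 (R : idomainType) (n : nat) : prod_comm 0 (1 : 'M[R]_n.+1).
Proof. by exists [::]. Qed.

Lemma prod_comm0P (R : idomainType) (n : nat) (g : 'M[R]_n.+1) :
  prod_comm 0 g <-> g = 1.
Proof.
split=> [[[|p s] [//= _ [_ ->]]]//|->]; exact: prod_comm0.
Qed.

Lemma prod_comm1 (R : idomainType) (n : nat) (A B : 'M[R]_n.+1) :
  inSL A -> inSL B -> prod_comm 1 (mxcomm A B).
Proof.
move=> sA sB; exists [:: (A, B)]; split=> //=; split; last by rewrite mulmx1.
by rewrite !asboolT.
Qed.

Lemma prod_commP (R : idomainType) (n : nat) k (g : 'M[R]_n.+1) :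
  prod_comm k.+1 g <->
  exists A B h, [/\ inSL A, inSL B, prod_comm k h & g = mxcomm A B * h].
Proof.
split=> [[[|[A B] s] [//= [ss] [/andP[/andP[/asboolP sA /asboolP sB] al] ->]]]|].
  by exists A, B, (foldr (fun p acc => mxcomm p.1 p.2 *m acc) 1%:M s); split=> //; exists s.
move=> [A [B [h [sA sB [s [ss [al ->]]] ->]]]]; exists ((A, B) :: s).
by rewrite /= ss al !asboolT.
Qed.

Lemma prod_comm_inSL (R : idomainType) (n : nat) k (g : 'M[R]_n.+1) :
  prod_comm k g -> inSL g.
Proof.
elim: k g => [|k IH] g; first by move=> /prod_comm0P ->; apply: inSL1.
by move=> /prod_commP[A [B [h [sA sB /IH sh ->]]]]; apply: inSLM => //; apply: mxcomm_inSL.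
Qed.

Lemma prod_commM (R : idomainType) (n : nat) k l (g h : 'M[R]_n.+1) :
  prod_comm k g -> prod_comm l h -> prod_comm (k + l) (g * h).
Proof.
move=> gk hl; elim: k g gk => [|k IH] g.
  by move=> /prod_comm0P ->; rewrite mul1r.
move=> /prod_commP[A [B [g' [sA sB /IH sh ->]]]]; rewrite addSn; apply/prod_commP.
by exists A, B, (g' * h); rewrite mulrA.
Qed.

(** Conjugation by any invertible matrix is an automorphism of [SL_n(R)], so it carries commutators
    to commutators. Asking only for a unit [x] makes permutation matrices of determinant -1
    available. *)
Lemma prod_comm_conj (R : idomainType) (n : nat) k (x g : 'M[R]_n.+1) :
  x \is a GRing.unit -> prod_comm k g -> prod_comm k (x * g * x^-1).
Proof.
move=> ux; elim: k g => [|k IH] g.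
  by move=> /prod_comm0P ->; rewrite mulr1 divrr //; apply: prod_comm0.
move=> /prod_commP[A [B [h [sA sB /IH sh ->]]]]; apply/prod_commP.
exists (x * A * x^-1), (x * B * x^-1), (x * h * x^-1); split=> //.
- exact: inSL_conj.
- exact: inSL_conj.
have uA := inSL_unit sA; have uB := inSL_unit sB.
have ux' : x^-1 \is a GRing.unit by rewrite unitrV.
have iv (C : 'M[R]_n.+1) : C \is a GRing.unit -> (x * C * x^-1)^-1 = x * C^-1 * x^-1.
  move=> uC; rewrite invrM // ?invrM ?invrK ?mulrA //.
  by rewrite unitrMr.
by rewrite !mxcommE !iv // !mulrA !mulrVK.
Qed.

Lemma prod_comm_le (R : idomainType) (n : nat) k l (g : 'M[R]_n.+1) :
  (k <= l)%N -> prod_comm k g -> prod_comm l g.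
Proof.
move=> /subnK <- gk; elim: (l - k)%N => [|i IH] //.
rewrite addSn; apply/prod_commP; exists 1, 1, g; split=> //; try exact: inSL1.
by rewrite mxcommE invr1 !mul1r.
Qed.

Lemma prod_commV (R : idomainType) (n : nat) k (g : 'M[R]_n.+1) :
  prod_comm k g -> prod_comm k g^-1.
Proof.
elim: k g => [|k IH] g.
  by move=> /prod_comm0P ->; rewrite invr1; apply: prod_comm0.
move=> /prod_commP[A [B [h [sA sB ph ->]]]].
have uA := inSL_unit sA; have uB := inSL_unit sB.
have uh := inSL_unit (prod_comm_inSL ph).
rewrite invrM ?(inSL_unit (mxcomm_inSL sA sB)) // -[k.+1]addn1.
apply: prod_commM; first exact: IH.
suff -> : (mxcomm A B)^-1 = mxcomm B A by apply: prod_comm1.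
by rewrite !mxcommE !invrM ?unitrMr ?unitrV // !invrK !mulrA.
Qed.

(** * Matrices whose powers have bounded commutator length *)

Definition bounded_powers (R : idomainType) (n : nat) (A : 'M[R]_n) : Prop :=
  exists c, forall k, prod_comm c (A ^+ k).

Lemma bounded_powers_inSL (R : idomainType) (n : nat) (A : 'M[R]_n.+1) :
  bounded_powers A -> inSL A.
Proof. by move=> [c /(_ 1)]; apply: prod_comm_inSL. Qed.

Lemma bounded_powers1 (R : idomainType) (n : nat) : bounded_powers (1 : 'M[R]_n.+1).
Proof. by exists 0%N => k; rewrite expr1n; apply: prod_comm0. Qed.

Lemma bounded_powers_conj (R : idomainType) (n : nat) (x A : 'M[R]_n.+1) :
  x \is a GRing.unit -> bounded_powers A -> bounded_powers (x * A * x^-1).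
Proof.
by move=> ux [c Ac]; exists c => k; rewrite conjr_exp //; apply: prod_comm_conj.
Qed.

Lemma bounded_powersM (R : idomainType) (n : nat) (A B : 'M[R]_n.+1) :
  GRing.comm A B -> bounded_powers A -> bounded_powers B -> bounded_powers (A * B).
Proof.
move=> cAB [c Ac] [d Bd]; exists (c + d)%N => k.
by rewrite exprMn_comm //; apply: prod_commM.
Qed.

Lemma bounded_powersV (R : idomainType) (n : nat) (A : 'M[R]_n.+1) :
  bounded_powers A -> bounded_powers A^-1.
Proof. by move=> [c Ac]; exists c => k; rewrite exprVn; apply: prod_commV. Qed.

(* The square of a power [a] of [A] is the single commutator [a * (x * a^-1 * x^-1)^-1]. *)
Lemma bounded_powers_reversible (R : idomainType) (n : nat) (x A : 'M[R]_n.+1) c :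
  inSL x -> prod_comm c A -> x * A * x^-1 = A^-1 -> bounded_powers A.
Proof.
move=> sx Ac xA; exists (1 + c)%N => k.
have ux := inSL_unit sx; have sA := prod_comm_inSL Ac.
rewrite -[k]odd_double_half [X in A ^+ X]addnC exprD; apply: prod_commM.
  set a := A ^+ k./2; have sa : inSL a by apply: inSLX.
  have ua := inSL_unit sa.
  have -> : A ^+ (k./2).*2 = mxcomm a^-1 x^-1.
    have xa : x * a * x^-1 = a^-1 by rewrite -conjr_exp // xA exprVn.
    have -> : A ^+ (k./2).*2 = a * a by rewrite -addnn exprD.
    rewrite mxcommE !invrK -!mulrA; congr (_ * _).
    have -> : a = (x * a * x^-1)^-1 by rewrite xa invrK.
    by rewrite !invrM ?unitrMr ?unitrV // !invrK xa !mulrA.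
  by apply: prod_comm1; apply: inSLV.
case: (odd k) => //=; rewrite expr0; apply: (@prod_comm_le _ _ 0) => //; exact: prod_comm0.
Qed.

Lemma mx_invE (R : comUnitRingType) (n : nat) (A B : 'M[R]_n.+1) :
  A * B = 1 -> A \is a GRing.unit /\ A^-1 = B.
Proof.
move=> AB; have [uA _] := mulmx1_unit AB.
by split; [exact: uA | rewrite -[LHS]mulr1 -AB mulKr].
Qed.

(** * Explicit two by two matrices *)

Definition mx2 (R : idomainType) (a b c d : R) : 'M[R]_2 :=
  \matrix_(i, j) if i == 0 then if j == 0 then a else b
                 else if j == 0 then c else d.

Lemma ord2P (i : 'I_2) : i = 0 \/ i = 1.
Proof. by case: i => [[|[|i]] // Hi]; [left|right]; apply: val_inj. Qed.

Lemma mx2P (R : idomainType) (A B : 'M[R]_2) :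
  A 0 0 = B 0 0 -> A 0 1 = B 0 1 -> A 1 0 = B 1 0 -> A 1 1 = B 1 1 -> A = B.
Proof.
by move=> *; apply/matrixP => i j; case: (ord2P i) => ->; case: (ord2P j) => ->.
Qed.

Lemma mx2_eta (R : idomainType) (A : 'M[R]_2) :
  A = mx2 (A 0 0) (A 0 1) (A 1 0) (A 1 1).
Proof. by apply: mx2P; rewrite !mxE. Qed.

Lemma mx2M (R : idomainType) (a b c d a' b' c' d' : R) :
  mx2 a b c d *m mx2 a' b' c' d' =
  mx2 (a * a' + b * c') (a * b' + b * d') (c * a' + d * c') (c * b' + d * d').
Proof. by apply: mx2P; rewrite !mxE !big_ord_recl big_ord0 !mxE /= addr0. Qed.

Lemma mx2D (R : idomainType) (a b c d a' b' c' d' : R) :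
  mx2 a b c d + mx2 a' b' c' d' = mx2 (a + a') (b + b') (c + c') (d + d').
Proof. by apply: mx2P; rewrite !mxE. Qed.

Lemma mx2N (R : idomainType) (a b c d : R) :
  - mx2 a b c d = mx2 (- a) (- b) (- c) (- d).
Proof. by apply: mx2P; rewrite !mxE. Qed.

Lemma mx2_1 (R : idomainType) : 1%:M = mx2 1 0 0 (1 : R).
Proof. by apply: mx2P; rewrite !mxE. Qed.

Lemma mx2_0 (R : idomainType) : 0 = mx2 0 0 0 (0 : R).
Proof. by apply: mx2P; rewrite !mxE. Qed.

Lemma det_mx2 (R : idomainType) (a b c d : R) :
  \det (mx2 a b c d) = a * d - b * c.
Proof.
rewrite (expand_det_row _ 0) !big_ord_recl big_ord0 /cofactor !det_mx11 !mxE /=.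
rewrite /bump /= expr0 expr1; ring.
Qed.

Lemma mx2_cong (R : idomainType) (a b c d a' b' c' d' : R) :
  a = a' -> b = b' -> c = c' -> d = d' -> mx2 a b c d = mx2 a' b' c' d'.
Proof. by move=> -> -> -> ->. Qed.

(** * Block triangular matrices in [SL_4(R)] *)

Definition blk (R : idomainType) (A X Y D : 'M[R]_2) : 'M[R]_4 := block_mx A X Y D.

Lemma blkM (R : idomainType) (A X Y D A' X' Y' D' : 'M[R]_2) :
  blk A X Y D * blk A' X' Y' D' =
  blk (A *m A' + X *m Y') (A *m X' + X *m D')
      (Y *m A' + D *m Y') (Y *m X' + D *m D').
Proof. exact: (@mulmx_block R 2 2 2 2 2 2). Qed.

Definition blk_simp := (mulmx0, mul0mx, mulmx1, mul1mx, addr0, add0r).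

Lemma blk1 (R : idomainType) : 1 = blk 1%:M 0 0 (1%:M : 'M[R]_2).
Proof. exact: (scalar_mx_block 2 2). Qed.

Lemma inSL_blk (R : idomainType) (A X D : 'M[R]_2) :
  inSL A -> inSL D -> inSL (blk A X 0 D).
Proof.
by rewrite /inSL => dA dD; rewrite -[LHS]/(\det (block_mx A X 0 D)) det_ublock dA dD mulr1.
Qed.

(* [P := mx2 1 1 (-1) 0] satisfies [(1 - P) * P = 1]; the commutator of
   [diag(P, 1)^-1] with the block unipotent of corner [P * X] has corner
   [(1 - P) * P * X = X]. *)
Lemma block_unipotent_comm (R : idomainType) (X : 'M[R]_2) :
  prod_comm 1 (blk 1%:M X 0 1%:M).
Proof.
pose P : 'M[R]_2 := mx2 1 1 (-1) 0.
pose Q : 'M[R]_2 := mx2 0 (-1) 1 1.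
have QP : Q *m P = 1%:M.
  by rewrite mx2M mx2_1; apply: mx2_cong; ring.
have PQ : P *m Q = 1%:M by apply: mulmx1C.
have PQ1 : - (P *m (P *m X)) + P *m X = X.
  rewrite -{2}[P *m X]mul1mx -mulNmx -mulmxDl mulmxA.
  have -> : (- P + 1%:M) *m P = 1%:M; last by rewrite mul1mx.
  by rewrite mx2N mx2_1 mx2D mx2M; apply: mx2_cong; ring.
have [uA iA] : blk Q 0 0 1%:M \is a GRing.unit /\ (blk Q 0 0 1%:M)^-1 = blk P 0 0 1%:M.
  by apply: mx_invE; rewrite blkM blk1 QP !blk_simp.
have [uB iB] : blk 1%:M (P *m X) 0 1%:M \is a GRing.unit /\
    (blk 1%:M (P *m X) 0 1%:M)^-1 = blk 1%:M (- (P *m X)) 0 1%:M.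
  by apply: mx_invE; rewrite blkM blk1 !blk_simp addNr.
have -> : blk 1%:M X 0 1%:M = mxcomm (blk Q 0 0 1%:M) (blk 1%:M (P *m X) 0 1%:M).
  rewrite mxcommE iA iB !blkM !blk_simp.
  by rewrite PQ mul1mx mulmxN addrC PQ1.
apply: prod_comm1; apply: inSL_blk => //.
by rewrite /inSL det_mx2; ring.
Qed.

Lemma blk_exp (R : idomainType) (A X D : 'M[R]_2) k :
  exists Y, blk A X 0 D ^+ k = blk (A ^+ k) Y 0 (D ^+ k).
Proof.
elim: k => [|k [Y IH]]; first by exists 0; rewrite !expr0 blk1.
exists (A *m Y + X *m D ^+ k).
by rewrite !exprS IH blkM !blk_simp.
Qed.

Lemma blk_diag_exp (R : idomainType) (A D : 'M[R]_2) k :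
  blk A 0 0 D ^+ k = blk (A ^+ k) 0 0 (D ^+ k).
Proof.
elim: k => [|k IH]; first by rewrite !expr0 blk1.
by rewrite !exprS IH blkM !blk_simp.
Qed.

Lemma blk_exp_diag (R : idomainType) (A X D : 'M[R]_2) k : inSL A ->
  exists Y, blk A X 0 D ^+ k = blk A 0 0 D ^+ k * blk 1%:M Y 0 1%:M.
Proof.
move=> sA; have [Y ->] := blk_exp A X D k; exists ((A ^+ k)^-1 *m Y).
have uA : A ^+ k \is a GRing.unit by apply/inSL_unit/inSLX.
rewrite blk_diag_exp blkM !blk_simp.
by rewrite mulmxA -[A ^+ k *m _]/(A ^+ k * _) divrr // mul1mx.
Qed.

(** The [k]-th powers of the two matrices differ by a block unipotent factor, hence by a single
    commutator, whatever [k] is. *)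
Lemma bounded_powers_blk (R : idomainType) (A X D : 'M[R]_2) : inSL A ->
  bounded_powers (blk A 0 0 D) <-> bounded_powers (blk A X 0 D).
Proof.
move=> sA; split=> -[c Ac]; exists (c + 1)%N => k;
  have [Y eY] := blk_exp_diag X D k sA.
  by rewrite eY; apply: prod_commM => //; apply: block_unipotent_comm.
have uN : blk 1%:M Y 0 1%:M \is a GRing.unit.
  by apply: inSL_unit; apply: inSL_blk.
rewrite -[_ ^+ k](mulrK uN) -eY; apply: prod_commM => //.
by apply: prod_commV; apply: block_unipotent_comm.
Qed.

Definition swap_blk (R : idomainType) : 'M[R]_4 := blk 0 1%:M 1%:M 0.

Lemma swap_blk_conj (R : idomainType) (A : 'M[R]_2) :
  swap_blk R \is a GRing.unit /\
  swap_blk R * blk A 0 0 1%:M * (swap_blk R)^-1 = blk 1%:M 0 0 A.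
Proof.
have [uS iS] : swap_blk R \is a GRing.unit /\ (swap_blk R)^-1 = swap_blk R.
  by apply: mx_invE; rewrite /swap_blk blkM blk1 !blk_simp.
split=> //; rewrite iS /swap_blk !blkM.
by rewrite !blk_simp.
Qed.

Lemma bounded_powers_swap (R : idomainType) (A : 'M[R]_2) :
  bounded_powers (blk A 0 0 1%:M) <-> bounded_powers (blk 1%:M 0 0 A).
Proof.
have [uS <-] := swap_blk_conj A; split; first exact: bounded_powers_conj.
have uV : (swap_blk R)^-1 \is a GRing.unit by rewrite unitrV.
by move=> /(bounded_powers_conj uV); rewrite invrK !mulrA mulVr // mul1r mulrVK.
Qed.

(** [diag(A, D)] is the product of the commuting matrices [diag(A, 1)] and [diag(1, D)], so the
    bounded factor [diag(A, 1)] cancels. A swap of blocks then moves [D] to the top. *)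
Lemma bounded_powers_blk_drop (R : idomainType) (A X D : 'M[R]_2) : inSL D ->
  bounded_powers (blk A 0 0 1%:M) -> bounded_powers (blk A X 0 D) ->
  bounded_powers (blk D 0 0 1%:M).
Proof.
move=> sD bA; have sA : inSL A.
  have := bounded_powers_inSL bA; rewrite /inSL -[\det _]/(\det (block_mx A 0 0 1%:M)).
  by rewrite det_ublock det1 mulr1.
move=> /(bounded_powers_blk _ _ sA) bAD; apply/bounded_powers_swap.
have uA : blk A 0 0 1%:M \is a GRing.unit by apply: inSL_unit; apply: inSL_blk.
have e : blk A 0 0 D = blk A 0 0 1%:M * blk 1%:M 0 0 D.
  by rewrite blkM !blk_simp.
have -> : blk 1%:M 0 0 D = (blk A 0 0 1%:M)^-1 * blk A 0 0 D by rewrite e mulKr.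
apply: bounded_powersM => //; last exact: bounded_powersV.
apply/commr_sym/commrV; rewrite /GRing.comm !blkM.
by rewrite !blk_simp.
Qed.

Lemma bounded_powers_blk_join (R : idomainType) (A X D : 'M[R]_2) :
  bounded_powers (blk A 0 0 1%:M) -> bounded_powers (blk D 0 0 1%:M) ->
  inSL A -> bounded_powers (blk A X 0 D).
Proof.
move=> bA /bounded_powers_swap bD sA; apply/bounded_powers_blk => //.
have -> : blk A 0 0 D = blk A 0 0 1%:M * blk 1%:M 0 0 D.
  by rewrite blkM !blk_simp.
apply: bounded_powersM => //; rewrite /GRing.comm !blkM.
by rewrite !blk_simp.
Qed.

Lemma inSL_mx2 (R : idomainType) (a b c d : R) :
  inSL (mx2 a b c d) <-> a * d - b * c = 1.
Proof. by rewrite /inSL det_mx2. Qed.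

(** * Elementary generation of [SL_2] over a euclidean ring *)

(** Euclid's algorithm on the bottom row, run by column operations. Since [m] can be replaced by
    [- m], [P] also descends from [A *m E] to [A] for elementary [E], so it suffices to reduce [A]
    to a diagonal matrix. *)
Lemma SL2_ind (R : idomainType) (P : 'M[R]_2 -> Prop) : euclidean_ring R ->
  P 1%:M ->
  (forall A m, inSL A -> P A -> P (A *m mx2 1 m 0 1)) ->
  (forall A m, inSL A -> P A -> P (A *m mx2 1 0 m 1)) ->
  forall A, inSL A -> P A.
Proof.
move=> [phi Ephi] P1 PU PL.
have sU m : inSL (mx2 1 m 0 (1 : R)) by apply/inSL_mx2; ring.
have sL m : inSL (mx2 1 0 m (1 : R)) by apply/inSL_mx2; ring.
have PUV A m : inSL A -> P (A *m mx2 1 m 0 1) -> P A.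
  move=> sA /(PU _ (- m) (inSLM sA (sU m))); rewrite -mulmxA mx2M; congr P.
  by rewrite -[RHS]mulmx1 mx2_1; congr (_ *m _); apply: mx2_cong; ring.
have PLV A m : inSL A -> P (A *m mx2 1 0 m 1) -> P A.
  move=> sA /(PL _ (- m) (inSLM sA (sL m))); rewrite -mulmxA mx2M; congr P.
  by rewrite -[RHS]mulmx1 mx2_1; congr (_ *m _); apply: mx2_cong; ring.
(* The rotation is the product [E_12(-1) E_21(1) E_12(-1)]. *)
have PW A : inSL A -> P (A *m mx2 0 (-1) 1 0) -> P A.
  move=> sA PA; apply: (PUV _ (-1)) => //; apply: (PLV _ 1); first exact: (inSLM sA (sU _)).
  apply: (PUV _ (-1)); first exact: (inSLM (inSLM sA (sU _)) (sL _)).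
  move: PA; congr P; rewrite -!mulmxA; congr (_ *m _).
  by rewrite !mx2M; apply: mx2_cong; ring.
(* Whitehead's identity: [diag(u, v)] times the rotation is [E_12(-u) E_21(v) E_12(-u)]. *)
have PD u v : u * v = 1 -> P (mx2 u 0 0 v).
  move=> uv; have vu : v * u = 1 by rewrite mulrC.
  have e : mx2 u 0 0 v *m mx2 0 (-1) 1 0 =
           1%:M *m mx2 1 (- u) 0 1 *m mx2 1 0 v 1 *m mx2 1 (- u) 0 1.
    by rewrite mx2_1 !mx2M; apply: mx2_cong; ring: uv.
  apply: (PW); first by apply/inSL_mx2; rewrite uv; ring.
  rewrite e.
  apply: (PU); first exact: (inSLM (inSLM (inSL1 _ _) (sU _)) (sL _)).
  by apply: (PL); [exact: (inSLM (inSL1 _ _) (sU _)) | apply: (PU)].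
have P0 p q s : inSL (mx2 p q 0 s) -> P (mx2 p q 0 s).
  move=> /inSL_mx2 d; have ps : p * s = 1 by rewrite -d; ring.
  have -> : mx2 p q 0 s = mx2 p 0 0 s *m mx2 1 (s * q) 0 1.
    by rewrite mx2M; apply: mx2_cong; ring: ps.
  by apply: (PU); [apply/inSL_mx2; rewrite ps; ring | exact: PD].
have main N : forall p q r s, (phi r < N)%N -> inSL (mx2 p q r s) -> P (mx2 p q r s).
  elim: N => [|N IH] // p q r s rN sA.
  have [r0|r0] := eqVneq r 0; first by move: sA; rewrite r0; apply: P0.
  have [k [t [es tr]]] := Ephi s r r0.
  (* With [s = k * r + t], the bottom row [(r, s)] becomes [(r, t)] and then [(t, - r)], so [phi] of
     its left entry drops unless [t = 0]. *)
  apply: (PUV _ (- k)) => //; apply: (PW); first exact: (inSLM sA (sU _)).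
  have sA' : inSL (mx2 p q r s *m mx2 1 (- k) 0 1 *m mx2 0 (-1) 1 0).
    by apply: (inSLM (inSLM sA (sU _))); apply/inSL_mx2; ring.
  move: sA'; rewrite !mx2M.
  have -> : (r * 1 + s * 0) * 0 + (r * - k + s * 1) * 1 = t by rewrite es; ring.
  case: tr => [->|tr]; first exact: P0.
  by apply: IH; apply: leq_trans tr _.
by move=> A; rewrite [A]mx2_eta; apply: (main (phi (A 1 0)).+1).
Qed.

(** * Commutators and bounded powers for [SL_2(R)] inside [SL_4(R)] *)

(** In the commutator of the upper and lower block unipotents with corners [X] and [Y], every term
    containing [Y *m X] vanishes. Elementary matrices have the form [1 + X *m Y] of this kind. *)
Lemma prod_comm_blk1D (R : idomainType) (X Y : 'M[R]_2) :
  Y *m X = 0 -> prod_comm 1 (blk (1%:M + X *m Y) 0 0 1%:M).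
Proof.
move=> YX.
have [uA iA] : blk 1%:M X 0 1%:M \is a GRing.unit /\
    (blk 1%:M X 0 1%:M)^-1 = blk 1%:M (- X) 0 1%:M.
  by apply: mx_invE; rewrite blkM blk1 !blk_simp addNr.
have [uB iB] : blk 1%:M 0 Y 1%:M \is a GRing.unit /\
    (blk 1%:M 0 Y 1%:M)^-1 = blk 1%:M 0 (- Y) 1%:M.
  by apply: mx_invE; rewrite blkM blk1 !blk_simp subrr.
have -> : blk (1%:M + X *m Y) 0 0 1%:M = mxcomm (blk 1%:M X 0 1%:M) (blk 1%:M 0 Y 1%:M).
  rewrite mxcommE iA iB !blkM !(mulNmx, mulmxN, opprK, mulmxDl, blk_simp).
  rewrite -!mulmxA !YX !(mulmx0, oppr0, blk_simp).
  by rewrite [Y *m (X *m Y)]mulmxA YX !(subrr, addNr, oppr0, blk_simp).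
apply: prod_comm1; rewrite /inSL; first exact: inSL_blk.
by rewrite -[\det _]/(\det (block_mx 1%:M 0 Y 1%:M)) det_lblock !det1 mulr1.
Qed.

Lemma prod_comm_upper (R : idomainType) (a : R) :
  prod_comm 1 (blk (mx2 1 a 0 1) 0 0 1%:M).
Proof.
have := @prod_comm_blk1D R (mx2 a 0 0 0) (mx2 0 1 0 0).
rewrite !mx2M mx2_1 mx2D mx2_0 => H.
have -> : mx2 1 a 0 1 = mx2 (1 + (a * 0 + 0 * 0)) (0 + (a * 1 + 0 * 0))
  (0 + (0 * 0 + 0 * 0)) (1 + (0 * 1 + 0 * 0)) by apply: mx2_cong; ring.
by apply: H; apply: mx2_cong; ring.
Qed.

Lemma prod_comm_lower (R : idomainType) (a : R) :
  prod_comm 1 (blk (mx2 1 0 a 1) 0 0 1%:M).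
Proof.
have := @prod_comm_blk1D R (mx2 0 0 0 a) (mx2 0 0 1 0).
rewrite !mx2M mx2_1 mx2D mx2_0 => H.
have -> : mx2 1 0 a 1 = mx2 (1 + (0 * 0 + 0 * 1)) (0 + (0 * 0 + 0 * 0))
  (0 + (0 * 0 + a * 1)) (1 + (0 * 0 + a * 0)) by apply: mx2_cong; ring.
by apply: H; apply: mx2_cong; ring.
Qed.

Lemma blk_diagM (R : idomainType) (A B : 'M[R]_2) :
  blk (A *m B) 0 0 1%:M = blk A 0 0 1%:M * blk B 0 0 1%:M.
Proof. by rewrite blkM !blk_simp. Qed.

(** Here [c] depends on [A]; its finiteness is what the reversibility argument requires to absorb
    the leftover factor of an odd power. *)
Lemma prod_comm_SL2 (R : idomainType) (A : 'M[R]_2) : euclidean_ring R ->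
  inSL A -> exists c, prod_comm c (blk A 0 0 1%:M).
Proof.
move=> eR; move: A; apply: SL2_ind => //.
- by exists 0%N; rewrite -blk1; apply: prod_comm0.
- move=> A m _ [c Ac]; exists (c + 1)%N; rewrite blk_diagM.
  by apply: prod_commM => //; apply: prod_comm_upper.
- move=> A m _ [c Ac]; exists (c + 1)%N; rewrite blk_diagM.
  by apply: prod_commM => //; apply: prod_comm_lower.
Qed.

(* Conjugation by the involution [x] inverts the companion-like matrix. *)
Lemma bounded_powers_companion (R : idomainType) (p q s : R) : euclidean_ring R ->
  inSL (mx2 p q 1 s) -> bounded_powers (blk (mx2 p q 1 s) 0 0 1%:M).
Proof.
move=> eR sB; have [c Bc] := prod_comm_SL2 eR sB.
pose x : 'M[R]_2 := mx2 p (1 - p ^+ 2) 1 (- p).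
have xx : x *m x = 1%:M by rewrite mx2M mx2_1; apply: mx2_cong; ring.
have [ux ix] : blk x 0 0 x \is a GRing.unit /\ (blk x 0 0 x)^-1 = blk x 0 0 x.
  by apply: mx_invE; rewrite blkM blk1 !blk_simp xx.
have d : q = p * s - 1 by move/inSL_mx2: sB => <-; ring.
have [uB iB] : blk (mx2 p q 1 s) 0 0 1%:M \is a GRing.unit /\
    (blk (mx2 p q 1 s) 0 0 1%:M)^-1 = blk (mx2 s (- q) (-1) p) 0 0 1%:M.
  apply: mx_invE; rewrite -blk_diagM mx2M blk1 mx2_1; congr (blk _ 0 0 _).
  by rewrite d; apply: mx2_cong; ring.
apply: (bounded_powers_reversible (x := blk x 0 0 x) _ Bc).
  rewrite /inSL -[\det _]/(\det (block_mx x 0 0 x)) det_lblock det_mx2; ring.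
rewrite ix iB !blkM !blk_simp xx !mx2M d; congr (blk _ 0 0 _).
by apply: mx2_cong; ring.
Qed.

(* With [r | s - s'], the kernel of [R^2 + R^2 -> R/r, (x, y) |-> x_2 - y_2]
   is free with basis [e_1, r e_2, f_1, e_2 + f_2], and is stable under
   [A + A'].  [M1] is the action in this basis; it extends [A'] by the action
   on the submodule [y = 0].  In the basis [f_1, r f_2, e_1, e_2 + f_2] the
   same endomorphism [M2] extends [A] by the action on [x = 0].  The change of
   basis [S] is an involution; all identities are polynomial, so [r = 0] is
   allowed. *)
Lemma bounded_powers_bottom_row (R : idomainType) (p q r s p' q' s' m : R) :
  euclidean_ring R -> inSL (mx2 p q r s) -> inSL (mx2 p' q' r s') ->
  s = s' + r * m ->
  bounded_powers (blk (mx2 p' q' r s') 0 0 1%:M) ->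
  bounded_powers (blk (mx2 p q r s) 0 0 1%:M).
Proof.
move=> eR sA sA' es bA'.
have sB : inSL (mx2 p (r * q) 1 s).
  by move/inSL_mx2: sA => sA; apply/inSL_mx2; rewrite -[RHS]sA; ring.
have sB' : inSL (mx2 p' (r * q') 1 s').
  by move/inSL_mx2: sA' => sA'; apply/inSL_mx2; rewrite -[RHS]sA'; ring.
pose M1 := blk (mx2 p (r * q) 1 s) (mx2 0 q (-1) m) 0 (mx2 p' q' r s').
pose M2 := blk (mx2 p' (r * q') 1 s') (mx2 0 q' (-1) (- m)) 0 (mx2 p q r s).
pose S : 'M[R]_4 := blk (mx2 0 0 0 (-1)) (mx2 1 0 0 0) (mx2 1 0 0 r) (mx2 0 0 0 1).
have [uS iS] : S \is a GRing.unit /\ S^-1 = S.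
  apply: mx_invE; rewrite blkM blk1 !mx2M !mx2D mx2_0 mx2_1.
  by congr blk; apply: mx2_cong; ring.
have bM1 : bounded_powers M1.
  by apply: bounded_powers_blk_join => //; apply: bounded_powers_companion.
have M12 : S * M1 * S^-1 = M2.
  rewrite iS /S /M1 /M2 mx2_0 !blkM !mx2M !mx2D !mx2M !mx2D es.
  by congr blk; apply: mx2_cong; ring.
have bM2 : bounded_powers M2 by rewrite -M12; apply: bounded_powers_conj.
exact: (bounded_powers_blk_drop sA (bounded_powers_companion eR sB') bM2).
Qed.

Lemma bounded_powers_SL2 (R : idomainType) (A : 'M[R]_2) : euclidean_ring R ->
  inSL A -> bounded_powers (blk A 0 0 1%:M).
Proof.
move=> eR.
have sU m : inSL (mx2 1 m 0 (1 : R)) by apply/inSL_mx2; ring.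
have sL m : inSL (mx2 1 0 m (1 : R)) by apply/inSL_mx2; ring.
(* Right multiplication by [E_12(m)] keeps the first column and replaces [s] by [s + r * m]. *)
have step (B : 'M[R]_2) m : inSL B -> bounded_powers (blk B 0 0 1%:M) ->
    bounded_powers (blk (B *m mx2 1 m 0 1) 0 0 1%:M).
  rewrite [B]mx2_eta => sB; move: (inSLM sB (sU m)); rewrite mx2M !mulr0 !mulr1 !addr0.
  by move=> sBm; apply: (bounded_powers_bottom_row (m := m)) => //; rewrite addrC.
pose w : 'M[R]_2 := mx2 0 (-1) 1 0.
pose w' : 'M[R]_2 := mx2 0 1 (-1) 0.
have ww' : w *m w' = 1%:M by rewrite mx2M mx2_1; apply: mx2_cong; ring.
have w'w : w' *m w = 1%:M by apply: mulmx1C.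
have sw : inSL w by apply/inSL_mx2; ring.
have sw' : inSL w' by apply/inSL_mx2; ring.
have [uw iw] : blk w 0 0 1%:M \is a GRing.unit /\ (blk w 0 0 1%:M)^-1 = blk w' 0 0 1%:M.
  by apply: mx_invE; rewrite -blk_diagM ww' blk1.
have [uw' iw'] : blk w' 0 0 1%:M \is a GRing.unit /\ (blk w' 0 0 1%:M)^-1 = blk w 0 0 1%:M.
  by apply: mx_invE; rewrite -blk_diagM w'w blk1.
move: A; apply: SL2_ind => //.
  by rewrite -blk1; apply: bounded_powers1.
move=> B m sB bB.
(* The lower case reduces to the upper one through [E_21(m) = w' E_12(-m) w]. *)
have -> : B *m mx2 1 0 m 1 = w' *m (w *m B *m w' *m mx2 1 (- m) 0 1) *m w.
  rewrite !mulmxA w'w mul1mx -!mulmxA; congr (_ *m _).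
  by rewrite !mx2M; apply: mx2_cong; ring.
rewrite !blk_diagM -[X in _ * X]iw'; apply: bounded_powers_conj => //.
rewrite -!blk_diagM; apply: step; first exact: (inSLM (inSLM sw sB) sw').
by rewrite !blk_diagM -iw; apply: bounded_powers_conj.
Qed.

(** * Copies of [SL_2] on coordinate planes *)

Definition plane_incl (R : idomainType) (n : nat) (i j : 'I_n) : 'M[R]_(n, 2) :=
  \matrix_(l, k) (l == if k == 0 then i else j)%:R.

(** For [i != j], this is [A] acting on the plane spanned by [e_i] and [e_j], with the other basis
    vectors fixed. *)
Definition plane_mx (R : idomainType) (n : nat) (i j : 'I_n) (A : 'M[R]_2) : 'M[R]_n :=
  1%:M + plane_incl R i j *m (A - 1%:M) *m (plane_incl R i j)^T.

Lemma plane_incl_orth (R : idomainType) (n : nat) (i j : 'I_n) : i != j ->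
  (plane_incl R i j)^T *m plane_incl R i j = 1%:M.
Proof.
move=> ij; apply: mx2P; rewrite !mxE.
- rewrite (bigD1 i) //= !mxE /= eqxx mulr1 big1 ?addr0 // => l /negPf li.
  by rewrite !mxE /= li mulr0.
- rewrite big1 // => l _; rewrite !mxE /=.
  by case: (eqVneq l i) => [->|_]; rewrite ?(negPf ij) ?mul0r ?mulr0.
- rewrite big1 // => l _; rewrite !mxE /=.
  by case: (eqVneq l i) => [->|_]; rewrite ?(negPf ij) ?mul0r ?mulr0.
- rewrite (bigD1 j) //= !mxE /= eqxx mulr1 big1 ?addr0 // => l /negPf li.
  by rewrite !mxE /= li mulr0.
Qed.

Lemma tr_plane_incl_mul (R : idomainType) (n m : nat) (i j : 'I_n) (c : 'M[R]_(n, m)) k l :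
  ((plane_incl R i j)^T *m c) k l = c (if k == 0 then i else j) l.
Proof.
rewrite mxE (bigD1 (if k == 0 then i else j)) //= !mxE /= eqxx mul1r big1 ?addr0 //.
by move=> t /negPf tk; rewrite !mxE tk mul0r.
Qed.

Lemma plane_incl_mul (R : idomainType) (n m : nat) (i j : 'I_n) (z : 'M[R]_(2, m)) k l :
  (plane_incl R i j *m z) k l = (k == i)%:R * z 0 l + (k == j)%:R * z 1 l.
Proof.
rewrite mxE !big_ord_recl big_ord0 !mxE /= addr0.
by congr (_ + _ * z _ _); apply: val_inj.
Qed.

Lemma perm2 (n : nat) (i0 j0 i j : 'I_n) : i0 != j0 -> i != j ->
  exists s : {perm 'I_n}, s i0 = i /\ s j0 = j.
Proof.
move=> ij0 ij; exists (tperm i0 i * tperm (tperm i0 i j0) j)%g.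
rewrite !permM tpermL; split; last by rewrite tpermL.
rewrite [LHS]tpermD //; last by rewrite eq_sym.
by rewrite -[X in _ != X](tpermL i0 i) (inj_eq perm_inj) eq_sym.
Qed.

(** A permutation matrix carries one coordinate plane to the other; its determinant may be -1, so
    [x] is only a unit. *)
Lemma plane_mx_conj (R : idomainType) (n : nat) (i0 j0 i j : 'I_n.+1) (A : 'M[R]_2) :
  i0 != j0 -> i != j ->
  exists x : 'M[R]_n.+1, x \is a GRing.unit /\
    plane_mx i j A = x * plane_mx i0 j0 A * x^-1.
Proof.
move=> ij0 ij; have [s [si sj]] := perm2 ij ij0.
have [ux ix] : (perm_mx s : 'M[R]_n.+1) \is a GRing.unit /\
    (perm_mx s : 'M[R]_n.+1)^-1 = (perm_mx s)^T.
  apply: mx_invE; rewrite tr_perm_mx -[_ * _]/(_ *m _) -perm_mxM mulgV.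
  by rewrite perm_mx1.
exists (perm_mx s); split=> //; rewrite ix.
have sU : perm_mx s *m plane_incl R i0 j0 = plane_incl R i j.
  rewrite -row_permE; apply/matrixP => l k; rewrite !mxE.
  by case: (k == 0); rewrite -?si -?sj (inj_eq perm_inj).
rewrite -[_ * _ * _]/(_ *m _ *m _) /plane_mx mulmxDr mulmxDl mulmx1 -ix; congr (_ + _).
  by rewrite -[RHS]/(_ * _) mulrV.
by rewrite ix !mulmxA sU -!mulmxA -trmx_mul sU.
Qed.

Lemma plane_mx01 (R : idomainType) (n : nat) (A : 'M[R]_2) :
  plane_mx 0 1 A = block_mx A 0 0 1%:M :> 'M[R]_(2 + n).
Proof.
have -> : block_mx A 0 0 1%:M = 1%:M + block_mx (A - 1%:M) 0 0 0 :> 'M[R]_(2 + n).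
  by rewrite (scalar_mx_block 2 n) add_block_mx !addr0 addrC subrK.
congr (_ + _); set B := A - 1%:M.
have UB (U : 'M[R]_(2 + n, 2)) : U = col_mx 1%:M 0 -> U *m B *m U^T = block_mx B 0 0 0.
  move=> ->; rewrite tr_col_mx trmx1 trmx0 mul_col_mx mul1mx mul0mx mul_col_row.
  by rewrite !(mulmx1, mulmx0).
apply: UB; apply/matrixP => l k; rewrite -[l](@splitK 2 n).
case: (fintype.split l) => t /=; rewrite ?col_mxEu ?col_mxEd !mxE.
  by case: (ord2P t) => ->; case: (ord2P k) => ->.
by case: (ord2P k) => ->.
Qed.

Lemma inSL_plane (R : idomainType) (n : nat) (i j : 'I_n.+2) (A : 'M[R]_2) :
  i != j -> inSL A -> inSL (plane_mx i j A).
Proof.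
move=> ij sA; have [x [ux ->]] := @plane_mx_conj R n.+1 0 1 i j A isT ij.
apply: inSL_conj => //; rewrite plane_mx01.
by rewrite /inSL -[\det _]/(\det (block_mx A 0 0 1%:M)) det_lblock det1 mulr1.
Qed.

(** * Gaussian elimination with a fixed number of plane matrices *)

Fixpoint plane_prod (R : idomainType) (n N : nat) (g : 'M[R]_n) : Prop :=
  if N is N'.+1 then
    exists i j A h, [/\ i != j, inSL A, plane_prod N' h & g = plane_mx i j A *m h]
  else g = 1%:M.

Lemma plane_prodM (R : idomainType) (n N M : nat) (g h : 'M[R]_n) :
  plane_prod N g -> plane_prod M h -> plane_prod (N + M) (g *m h).
Proof.
move=> gN hM; elim: N g gN => [|N IH] g /=; first by move=> ->; rewrite mul1mx.
move=> [i [j [A [g' [ij sA /IH gh ->]]]]]; exists i, j, A, (g' *m h).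
by rewrite mulmxA.
Qed.

Lemma plane_prod1 (R : idomainType) (n : nat) (i j : 'I_n) (A : 'M[R]_2) :
  i != j -> inSL A -> plane_prod 1 (plane_mx i j A).
Proof. by move=> ij sA; exists i, j, A, 1%:M; rewrite mulmx1. Qed.

Lemma plane_prod_inSL (R : idomainType) (n N : nat) (g : 'M[R]_n.+2) :
  plane_prod N g -> inSL g.
Proof.
elim: N g => [|N IH] g /=; first by move=> ->; apply: inSL1.
move=> [i [j [A [g' [ij sA /IH gh ->]]]]].
by apply: inSLM => //; apply: inSL_plane.
Qed.

(** Extended Euclid in matrix form: [w] carries a common divisor of the entries of [y], and the
    cofactors fill [A]. *)
Lemma bezout_SL2 (R : idomainType) (y : 'cV[R]_2) : euclidean_ring R ->
  exists A (w : 'cV[R]_2), [/\ inSL A, y = A *m w & w 1 0 = 0].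
Proof.
move=> [phi Ephi].
have main N : forall a b, (phi b < N)%N ->
    exists x z t u d, [/\ x * u - z * t = 1, a = x * d & b = t * d].
  elim: N => [|N IH] // a b bN.
  have [->|b0] := eqVneq b 0; first by exists 1, 0, 0, 1, a; split; ring.
  have [q [r [ea rb]]] := Ephi a b b0.
  have base : exists x z t u d, [/\ x * u - z * t = 1, - b = x * d & r = t * d].
    case: rb => [->|rb]; last by apply: IH; apply: leq_trans rb _.
    by exists 1, 0, 0, 1, (- b); split; ring.
  case: base => [x [z [t [u [d [det eb er]]]]]].
  (* The inductive matrix multiplied on the left by [mx2 (- q) 1 (-1) 0], which sends [(- b, r)] to
     [(a, b)]. The sign in [- b] keeps the determinant equal to 1. *)
  exists (t - q * x), (u - q * z), (- x), (- z), d; split.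
  - by rewrite -[RHS]det; ring.
  - by rewrite ea er -[b]opprK eb; ring.
  - by rewrite mulNr -eb opprK.
have [x [z [t [u [d [det ea eb]]]]]] := main _ (y 0 0) (y 1 0) (ltnSn _).
exists (mx2 x z t u), (\col_i (if i == 0 then d else 0)); split.
- exact/inSL_mx2.
- apply/matrixP => i k; rewrite (ord1 k) !mxE !big_ord_recl big_ord0 !mxE /= mulr0 !addr0.
  by case: (ord2P i) => ->.
- by rewrite mxE.
Qed.

(** One Bezout step in the plane [(0, j)] clears entry [j] and otherwise alters only entry [0], so
    entries cleared earlier stay zero. *)
Lemma clear_col (R : idomainType) (n : nat) (c : 'cV[R]_n.+1) (js : seq 'I_n.+1) :
  euclidean_ring R -> 0 \notin js ->
  exists h c', [/\ plane_prod (size js) h, c = h *m c' &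
    forall j, j \in js -> c' j 0 = 0].
Proof.
move=> eR; elim: js => [|j js IH] /=; first by exists 1%:M, c; rewrite mul1mx.
rewrite inE negb_or => /andP[j0 js0]; have [h [c' [hN -> c'0]]] := IH js0.
pose U := plane_incl R 0 j.
have [A [w [sA ew w0]]] := bezout_SL2 (U^T *m c') eR.
exists (h *m plane_mx 0 j A), (c' - U *m (U^T *m c' - w)).
have eU : U^T *m (c' - U *m (U^T *m c' - w)) = w.
  by rewrite mulmxBr mulmxA plane_incl_orth // mul1mx opprB addrC subrK.
split.
- by have := plane_prodM hN (plane_prod1 j0 sA); rewrite addn1.
- rewrite -mulmxA; congr (_ *m _); rewrite /plane_mx mulmxDl mul1mx -mulmxA eU.
  by rewrite -[_ *m _ *m w]mulmxA mulmxBl mul1mx -ew subrK.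
- move=> k; rewrite inE; have [-> _|kj /= kjs] := eqVneq k j.
    have := tr_plane_incl_mul 0 j (c' - U *m (U^T *m c' - w)) 1 0.
    by rewrite -/U eU w0 /= => <-.
  have k0 : k != 0 by apply: contraNneq js0 => <-.
  rewrite mxE [X in _ + X]mxE plane_incl_mul (negPf k0) (negPf kj) !mul0r addr0 subr0.
  exact: c'0.
Qed.

Lemma plane_mx_block_dr (R : idomainType) (n : nat) (i j : 'I_n) (A : 'M[R]_2) :
  plane_mx (rshift 1 i) (rshift 1 j) A = block_mx 1%:M 0 0 (plane_mx i j A).
Proof.
rewrite /plane_mx; have -> : plane_incl R (rshift 1 i) (rshift 1 j) =
    col_mx 0 (plane_incl R i j).
  apply/matrixP => l k; rewrite -[l](@splitK 1 n).
  case: (fintype.split l) => t /=; rewrite ?col_mxEu ?col_mxEd !mxE.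
    by case: (k == 0); rewrite eq_lrshift.
  by case: (k == 0); rewrite eq_rshift.
rewrite tr_col_mx trmx0 mul_col_mx mul0mx mul_col_row !(mulmx0, mul0mx).
by rewrite (scalar_mx_block 1 n) add_block_mx !addr0.
Qed.

Lemma plane_prod_block_dr (R : idomainType) (n N : nat) (g : 'M[R]_n) :
  plane_prod N g -> plane_prod N (block_mx 1%:M 0 0 g : 'M[R]_(1 + n)).
Proof.
elim: N g => [|N IH] g /=; first by move=> ->; rewrite -scalar_mx_block.
move=> [i [j [A [g' [ij sA /IH gh ->]]]]].
exists (rshift 1 i), (rshift 1 j), A, (block_mx 1%:M 0 0 g'); split=> //.
by rewrite plane_mx_block_dr mulmx_block !(mulmx0, mul0mx, mulmx1, addr0, add0r).
Qed.

Lemma plane_mx_row (R : idomainType) (n : nat) (j : 'I_n) (a : R) :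
  plane_mx (lshift n 0) (rshift 1 j) (mx2 1 a 0 1) =
  block_mx 1%:M (a *: delta_mx 0 j) 0 1%:M.
Proof.
rewrite /plane_mx; have -> : plane_incl R (lshift n 0) (rshift 1 j) =
    col_mx (delta_mx 0 0) (delta_mx j 1).
  apply/matrixP => l k; rewrite -[l](@splitK 1 n).
  case: (fintype.split l) => t /=; rewrite ?col_mxEu ?col_mxEd !mxE.
    by rewrite (ord1 t); case: (ord2P k) => ->; rewrite /= ?eq_lshift ?eq_lrshift.
  by case: (ord2P k) => ->; rewrite /= ?andbT ?andbF ?eq_rshift ?eq_rlshift.
have -> : mx2 1 a 0 1 - 1%:M = a *: delta_mx 0 1.
  by apply: mx2P; rewrite !mxE /= ?subrr ?subr0 ?mulr0 ?mulr1.
rewrite tr_col_mx !trmx_delta mul_col_mx -!scalemxAr mul_col_row -!scalemxAl.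
have -> : delta_mx 0 0 *m (delta_mx 0 1 : 'M[R]_2) = delta_mx 0 1 :> 'rV[R]_2.
  exact: mul_delta_mx.
have -> : (delta_mx 0 1 : 'rV[R]_2) *m delta_mx 1 j = delta_mx 0 j :> 'rV[R]_n.
  exact: mul_delta_mx.
have -> : delta_mx 0 1 *m (delta_mx 0 0 : 'cV[R]_2) = 0 :> 'rV[R]_1.
  exact: mul_delta_mx_0.
have -> : delta_mx j 1 *m (delta_mx 0 1 : 'M[R]_2) = 0 by exact: mul_delta_mx_0.
by rewrite !mul0mx !scaler0 (scalar_mx_block 1 n) add_block_mx !addr0 !add0r.
Qed.

(** The corner rows add under multiplication, so [v] is assembled entry by entry, at the cost of one
    plane matrix each. *)
Lemma plane_prod_row (R : idomainType) (n : nat) (v : 'rV[R]_n) :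
  plane_prod n (block_mx 1%:M v 0 1%:M : 'M[R]_(1 + n)).
Proof.
have main (js : seq 'I_n) : plane_prod (size js)
    (block_mx 1%:M (\sum_(j <- js) v 0 j *: delta_mx 0 j) 0 1%:M : 'M[R]_(1 + n)).
  elim: js => [|j js IH]; first by rewrite big_nil /= -scalar_mx_block.
  exists (lshift n 0), (rshift 1 j), (mx2 1 (v 0 j) 0 1),
    (block_mx 1%:M (\sum_(j <- js) v 0 j *: delta_mx 0 j) 0 1%:M); split=> //.
    by apply/inSL_mx2; ring.
  rewrite plane_mx_row mulmx_block !(mulmx0, mul0mx, mulmx1, mul1mx, addr0, add0r).
  by rewrite big_cons addrC.
by have := main (enum 'I_n); rewrite size_enum_ord big_enum /= -row_sum_delta.
Qed.

Lemma plane_mx_diag_col (R : idomainType) (n : nat) (i j : 'I_n) (d e : R) :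
  i != j -> plane_mx i j (mx2 d 0 0 e) *m delta_mx i 0 = d *: delta_mx i 0 :> 'cV[R]_n.
Proof.
move=> ij; have Ui : (plane_incl R i j)^T *m delta_mx i 0 = delta_mx 0 0 :> 'cV[R]_2.
  apply/matrixP => k l; rewrite tr_plane_incl_mul (ord1 l) !mxE.
  by case: (ord2P k) => -> /=; rewrite ?eqxx // eq_sym (negPf ij).
have Ud : plane_incl R i j *m delta_mx 0 0 = delta_mx i 0 :> 'cV[R]_n.
  apply/matrixP => k l; rewrite plane_incl_mul (ord1 l) !mxE /=.
  by rewrite mulr0 addr0 mulr1 andbT.
rewrite /plane_mx mulmxDl mul1mx -!mulmxA Ui.
have -> : (mx2 d 0 0 e - 1%:M) *m delta_mx 0 0 = (d - 1) *: delta_mx 0 0 :> 'cV[R]_2.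
  apply/matrixP => k l; rewrite (ord1 l) !mxE !big_ord_recl big_ord0 !mxE /=.
  by case: (ord2P k) => -> /=; ring.
by rewrite -scalemxAr Ud scalerBl scale1r addrC subrK.
Qed.

Lemma first_col_plane_prod (R : idomainType) (n : nat) (g : 'M[R]_n.+2) :
  euclidean_ring R -> inSL g ->
  exists h, plane_prod (n.+1 + 1) h /\ col 0 g = h *m delta_mx 0 0.
Proof.
move=> eR sg; pose js := [seq lift ord0 i | i : 'I_n.+1].
have js0 : 0 \notin js.
  by apply/negP => /mapP[i _ /eqP]; rewrite (negPf (neq_lift _ _)).
have [h [c [hN ec c0]]] := clear_col (col 0 g) eR js0.
have sjs : size js = n.+1 by rewrite size_map size_enum_ord.
rewrite sjs in hN.
pose d := c 0 0; have cd : c = d *: delta_mx 0 0.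
  apply/matrixP => i j; rewrite (ord1 j) !mxE.
  have [->|i0] := eqVneq i 0; first by rewrite mulr1.
  rewrite mulr0; apply: c0; have := i0; rewrite eq_sym => /unlift_some[k -> _].
  by apply: map_f; rewrite mem_enum.
(* The first column of [g] is [d] times that of [h], and [g^-1] sends it to [e_0]. Hence the corner
   entry of [g^-1 h] is an inverse of [d]. *)
have [e de] : exists e, d * e = 1.
  exists ((invmx g *m h) 0 0); have ug : g \in unitmx by rewrite unitmxE sg unitr1.
  have : invmx g *m col 0 g = delta_mx 0 0 by rewrite colE mulmxA mulVmx // mul1mx.
  rewrite ec cd mulmxA -scalemxAr -colE => /matrixP/(_ 0 0).
  by rewrite [RHS]mxE mxE [X in _ * X]mxE.
exists (h *m plane_mx 0 1 (mx2 d 0 0 e)); split.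
  by apply: plane_prodM => //; apply: plane_prod1 => //; apply/inSL_mx2; rewrite de; ring.
by rewrite -mulmxA plane_mx_diag_col // -cd.
Qed.

(** Induction on the size, starting from the trivial group [SL_1]. Once the first column is [e_0],
    the matrix is [diag(1, g')] times a block unipotent with a single row. *)
Lemma SL_plane_prod (R : idomainType) (n : nat) : euclidean_ring R ->
  exists N, forall g : 'M[R]_n.+1, inSL g -> plane_prod N g.
Proof.
move=> eR; elim: n => [|n [N IH]].
  exists 0%N => g sg /=; apply/matrixP => i j; rewrite (ord1 i) (ord1 j).
  by move: sg; rewrite /inSL det_mx11 => ->; rewrite mxE.
(* The first column takes [n.+1] clearings and one normalization, the lower right block [N] factors,
   the top row [n.+1]. *)
exists ((n.+1 + 1) + (N + n.+1))%N => g sg.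
have [h [hN ec]] := first_col_plane_prod eR sg.
have sh := plane_prod_inSL hN; have uh := inSL_unit sh.
have [g1 [sg1 -> cc]] : exists g1 : 'M[R]_(1 + n.+1),
    [/\ inSL g1, g = h *m g1 & col 0 g1 = delta_mx 0 0].
  exists (h^-1 *m g); split.
  - by apply: inSLM => //; apply: inSLV.
  - by rewrite mulmxA -[h *m _]/(h * h^-1) mulrV // mul1mx.
  - by rewrite colE -mulmxA -colE ec mulmxA -[_ *m h]/(h^-1 * h) mulVr // mul1mx.
have dl : dlsubmx g1 = 0.
  apply/matrixP => i j; move/matrixP/(_ (lift 0 i) 0): cc; rewrite (ord1 j) !mxE /= => cc0.
  by apply: etrans cc0; congr (g1 _ _); apply: val_inj.
have ul : ulsubmx g1 = 1%:M.
  apply/matrixP => i j; move/matrixP/(_ 0 0): cc; rewrite (ord1 i) (ord1 j) !mxE /= => cc0.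
  by apply: etrans cc0; congr (g1 _ _); apply: val_inj.
apply: plane_prodM => //; rewrite -[g1]submxK dl ul.
have -> : block_mx 1%:M (ursubmx g1) 0 (drsubmx g1) =
    block_mx 1%:M 0 0 (drsubmx g1) *m block_mx 1%:M (ursubmx g1) 0 1%:M.
  by rewrite mulmx_block !(mulmx0, mul0mx, mulmx1, mul1mx, addr0, add0r).
apply: plane_prodM; last exact: plane_prod_row.
apply: plane_prod_block_dr; apply: IH.
by have := sg1; rewrite /inSL -[X in \det X](submxK g1) dl det_ublock ul det1 mul1r.
Qed.

(** * Stabilization from [SL_4] to larger sizes *)

Definition pad_mx (R : idomainType) (n m : nat) (A : 'M[R]_n.+1) : 'M[R]_(n.+1 + m) :=
  block_mx A 0 0 1%:M.

Lemma pad_mxM (R : idomainType) (n m : nat) (A B : 'M[R]_n.+1) :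
  pad_mx m (A * B) = pad_mx m A * pad_mx m B.
Proof.
rewrite -[RHS]/(block_mx A 0 0 1%:M *m block_mx B 0 0 1%:M) mulmx_block.
by rewrite !(mulmx0, mul0mx, mulmx1, addr0, add0r).
Qed.

Lemma pad_mx1 (R : idomainType) (n m : nat) : pad_mx m (1 : 'M[R]_n.+1) = 1.
Proof. by rewrite /pad_mx -scalar_mx_block. Qed.

Lemma inSL_pad (R : idomainType) (n m : nat) (A : 'M[R]_n.+1) :
  inSL A -> inSL (pad_mx m A).
Proof.
by rewrite /inSL -[\det (pad_mx _ _)]/(\det (block_mx A 0 0 1%:M)) det_lblock det1 mulr1.
Qed.

Lemma pad_mxV (R : idomainType) (n m : nat) (A : 'M[R]_n.+1) :
  inSL A -> pad_mx m A^-1 = (pad_mx m A)^-1.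
Proof.
move=> sA; have [_ ->] // : pad_mx m A \is a GRing.unit /\ (pad_mx m A)^-1 = pad_mx m A^-1.
by apply: mx_invE; rewrite -pad_mxM mulrV ?pad_mx1 // inSL_unit.
Qed.

Lemma prod_comm_pad (R : idomainType) (n m c : nat) (A : 'M[R]_n.+1) :
  prod_comm c A -> prod_comm c (pad_mx m A).
Proof.
elim: c A => [|c IH] A; first by move/prod_comm0P ->; apply/prod_comm0P; rewrite pad_mx1.
move=> /prod_commP[B [C [h [sB sC /IH sh ->]]]]; apply/prod_commP.
exists (pad_mx m B), (pad_mx m C), (pad_mx m h); split=> //; try exact: inSL_pad.
by rewrite !mxcommE !pad_mxM !pad_mxV.
Qed.

Lemma bounded_powers_pad (R : idomainType) (n m : nat) (A : 'M[R]_n.+1) :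
  bounded_powers A -> bounded_powers (pad_mx m A).
Proof.
move=> [c Ac]; exists c => k; suff -> : pad_mx m A ^+ k = pad_mx m (A ^+ k).
  exact: prod_comm_pad.
by elim: k => [|k IH]; rewrite ?expr0 ?pad_mx1 // !exprS IH pad_mxM.
Qed.

Lemma plane_mx_pad (R : idomainType) (n m : nat) (i j : 'I_n.+1) (A : 'M[R]_2) :
  plane_mx (lshift m i) (lshift m j) A = pad_mx m (plane_mx i j A).
Proof.
rewrite /plane_mx; have -> : plane_incl R (lshift m i) (lshift m j) =
    col_mx (plane_incl R i j) 0.
  apply/matrixP => l k; rewrite -[l](@splitK n.+1 m).
  case: (fintype.split l) => t /=; rewrite ?col_mxEu ?col_mxEd !mxE.
    by case: (k == 0); rewrite eq_lshift.
  by case: (k == 0); rewrite eq_rlshift.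
rewrite tr_col_mx trmx0 mul_col_mx mul0mx mul_col_row !(mulmx0, mul0mx).
by rewrite (scalar_mx_block n.+1 m) add_block_mx !addr0.
Qed.

(** A permutation moves the plane to the first two coordinates, where the bound already holds in the
    upper left [SL_4]. *)
Lemma bounded_powers_plane (R : idomainType) (m : nat) (i j : 'I_(4 + m)) (A : 'M[R]_2) :
  euclidean_ring R -> i != j -> inSL A -> bounded_powers (plane_mx i j A).
Proof.
move=> eR ij sA.
have [x [ux ->]] := @plane_mx_conj R (3 + m)
  (lshift m (0 : 'I_4)) (lshift m (1 : 'I_4)) i j A isT ij.
apply: bounded_powers_conj => //.
suff bA : bounded_powers (plane_mx 0 1 A : 'M[R]_4).
  by have := bounded_powers_pad m bA; rewrite -plane_mx_pad.
by rewrite (plane_mx01 2); apply: bounded_powers_SL2.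
Qed.

(** * Uniform linear growth of commutator length along powers *)

(** The slope [N] is to be shared by the whole group, while [c] may depend on [g]. *)
Definition powers_bound (R : idomainType) (n N : nat) (g : 'M[R]_n) : Prop :=
  exists c, forall j, prod_comm (N * j + c) (g ^+ j).

(** Moving one more [b] past [a ^+ j] costs the single commutator [C], which is then conjugated to
    the right of [b ^+ j.+1]. *)
Lemma exprM_comm (R : idomainType) (n : nat) (a b : 'M[R]_n.+1) j :
  inSL a -> inSL b -> exists w, prod_comm j w /\ (a * b) ^+ j = a ^+ j * b ^+ j * w.
Proof.
move=> sa sb; have ua := inSL_unit sa; have ub := inSL_unit sb.
elim: j => [|j [w [wj e]]].
  by exists 1; rewrite !expr0 !mulr1; split=> //; apply: prod_comm0.
pose C := mxcomm (a ^+ j) b^-1.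
have ubj : b ^+ j.+1 \is a GRing.unit by rewrite unitrX.
exists ((b ^+ j.+1)^-1 * C * b ^+ j.+1 * w); split.
  rewrite -[j.+1]add1n; apply: prod_commM => //.
  rewrite -[X in _ * X]invrK; apply: prod_comm_conj; first by rewrite unitrV.
  by apply: prod_comm1; [apply: inSLX | apply: inSLV].
rewrite exprS e /C mxcommE invrK !mulrA mulrK // [a ^+ j.+1]exprS mulrK ?unitrX //.
by rewrite [b ^+ j.+1]exprS !mulrA mulrVK.
Qed.

Lemma powers_boundM (R : idomainType) (n N M : nat) (a b : 'M[R]_n.+1) :
  inSL a -> inSL b -> powers_bound N a -> powers_bound M b ->
  powers_bound (N + M + 1) (a * b).
Proof.
move=> sa sb [c ac] [d bd]; exists (c + d)%N => j.
have [w [wj ->]] := exprM_comm j sa sb.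
have -> : ((N + M + 1) * j + (c + d) = (N * j + c) + (M * j + d) + j)%N by lia.
by do !apply: prod_commM.
Qed.

Lemma SL_powers_bound (R : idomainType) (m : nat) : euclidean_ring R ->
  exists N, forall g : 'M[R]_(4 + m), inSL g -> powers_bound N g.
Proof.
move=> eR; have [N NP] := @SL_plane_prod R (3 + m) eR; exists N => g /NP.
elim: (N) g => [|k IH] g /=.
  by move=> ->; exists 0%N => j; rewrite mul0n expr1n; apply: prod_comm0.
move=> [i [j [A [h [ij sA hk ->]]]]].
(* A plane matrix has slope 0, so each factor adds only the 1 caused by multiplication. *)
have -> : k.+1 = (0 + k + 1)%N by lia.
apply: powers_boundM; last exact: IH; first exact: inSL_plane.
  exact: plane_prod_inSL hk.
have [c Pc] := bounded_powers_plane eR ij sA.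
by exists c => l; rewrite mul0n.
Qed.

(** * Uniform bounds for quasi-homomorphisms *)

Section QuasiHom.
Variables (R : idomainType) (n : nat) (K : realType) (psi : 'M[R]_n.+1 -> K) (D : K).
Hypothesis psiD : forall A B : 'M[R]_n.+1, inSL A -> inSL B ->
  `|psi (A *m B) - psi A - psi B| <= D.

Lemma quasi_hom_defect (A B : 'M[R]_n.+1) : inSL A -> inSL B ->
  - D <= psi (A * B) - psi A - psi B <= D.
Proof. by move=> sA sB; have := psiD sA sB; rewrite ler_norml. Qed.

(** The three products cost [3 * D]. Each of the sums [psi A^-1 + psi A] and [psi B^-1 + psi B] is
    at most [2 * D] in absolute value, as [psi 1] is at most [D]. *)
Lemma quasi_hom_comm (A B : 'M[R]_n.+1) : inSL A -> inSL B ->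
  - (7 * D) <= psi (mxcomm A B) <= 7 * D.
Proof.
move=> sA sB; rewrite mxcommE.
have sA' := inSLV sA; have sB' := inSLV sB.
have := quasi_hom_defect (inSL1 R n.+1) (inSL1 R n.+1).
have := quasi_hom_defect sA' sA; have := quasi_hom_defect sB' sB.
have := quasi_hom_defect sA' sB'; have := quasi_hom_defect (inSLM sA' sB') sA.
have := quasi_hom_defect (inSLM (inSLM sA' sB') sA) sB.
rewrite !mulVr ?inSL_unit // mul1r.
move=> /andP[? ?] /andP[? ?] /andP[? ?] /andP[? ?] /andP[? ?] /andP[? ?].
by apply/andP; split; lra.
Qed.

(** Each commutator contributes [7 * D] plus one defect for multiplying it in; the constant [D]
    bounds [psi 1]. *)
Lemma quasi_hom_prod_comm (k : nat) (g : 'M[R]_n.+1) : prod_comm k g ->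
  - (8 * D * k%:R + D) <= psi g <= 8 * D * k%:R + D.
Proof.
elim: k g => [|k IH] g.
  move/prod_comm0P ->; have := quasi_hom_defect (inSL1 R n.+1) (inSL1 R n.+1).
  by rewrite mul1r => /andP[? ?]; apply/andP; split; lra.
move=> /prod_commP[A [B [h [sA sB hk ->]]]].
have := quasi_hom_defect (mxcomm_inSL sA sB) (prod_comm_inSL hk).
have := quasi_hom_comm sA sB; have := IH _ hk; rewrite -natr1.
by move=> /andP[? ?] /andP[? ?] /andP[? ?]; apply/andP; split; lra.
Qed.

Lemma quasi_hom_exp (k : nat) (g : 'M[R]_n.+1) : inSL g ->
  - (D * k%:R + D) <= psi (g ^+ k) - k%:R * psi g <= D * k%:R + D.
Proof.
move=> sg; elim: k => [|k IH].
  have := quasi_hom_defect (inSL1 R n.+1) (inSL1 R n.+1); rewrite expr0 mul1r.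
  by move=> /andP[? ?]; apply/andP; split; lra.
have := quasi_hom_defect sg (inSLX k sg); rewrite exprS -natr1; move: IH.
by move=> /andP[? ?] /andP[? ?]; apply/andP; split; lra.
Qed.

Lemma quasi_hom_bound (N : nat) (g : 'M[R]_n.+1) : inSL g -> powers_bound N g ->
  `|psi g| <= D + 8 * D * N%:R + 1.
Proof.
move=> sg [c Pc].
have D0 : 0 <= D by have /andP[] := quasi_hom_defect sg sg; lra.
(* Two estimates of [psi (g ^+ j)] give [j * |psi g| <= (D + 8 * D * N) * j + x]. Taking [j > x] and
   dividing by [j] removes the dependence on [c]. *)
set x := 2 * D + 8 * D * c%:R.
have x0 : 0 <= x by rewrite addr_ge0 // !mulr_ge0 // ler0n.
pose j := (Num.bound x).+1; have jx : x < j%:R.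
  by apply: lt_trans (archi_boundP x0) _; rewrite ltr_nat.
have j0 : 0 < j%:R :> K by rewrite ltr0n.
have := quasi_hom_prod_comm (Pc j); rewrite natrD natrM => /andP[? ?].
have /andP[? ?] := quasi_hom_exp j sg.
rewrite ler_norml; apply/andP; split; rewrite -(ler_pM2l j0); move: jx; rewrite /x; lra.
Qed.

End QuasiHom.

(** * Vanishing of stable commutator length *)

Lemma cl_le (R : idomainType) (n k : nat) (g : 'M[R]_n) :
  prod_comm k g -> (cl g <= k)%N.
Proof.
move=> gk; rewrite /cl; case: pselect => // h; case: ex_minnP => i _; apply.
by rewrite asboolT.
Qed.

Lemma prod_comm_exp (R : idomainType) (n c k : nat) (g : 'M[R]_n.+1) :
  prod_comm c g -> prod_comm (c * k) (g ^+ k).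
Proof.
move=> gc; elim: k => [|k IH]; first by rewrite muln0; apply: prod_comm0.
by rewrite mulnS exprS; apply: prod_commM.
Qed.

Lemma powers_bound_scl0 (R : idomainType) (n N : nat) (K : realType) (g : 'M[R]_n.+1) :
  (forall h : 'M[R]_n.+1, inSL h -> powers_bound N h) -> inSL g -> scl_zero K g.
Proof.
move=> NP sg.
(* The slope bound is applied to [g ^+ k.+1], whose slope is again [N]; the remaining power, of
   exponent below [k.+1], costs at most [c2 * k.+1]. *)
have bound k : exists C, forall m, (cl (g ^+ m) <= N * (m %/ k.+1) + C)%N.
  have [c Pc] := NP _ (inSLX k.+1 sg).
  have [c1 /(_ 1%N)] := NP _ sg; rewrite expr1; set c2 := (_ + _)%N => gc2.
  exists (c + c2 * k.+1)%N => m; apply: cl_le.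
  rewrite {2}(divn_eq m k.+1) exprD [(m %/ _ * _)%N]mulnC exprM addnA.
  apply: prod_commM => //; apply: prod_comm_le (prod_comm_exp (m %% k.+1) gc2).
  by rewrite leq_mul2l (ltnW (ltn_pmod _ _)) ?orbT.
rewrite /scl_zero; apply/cvgrPdist_le => e e0.
have N0 : 0 <= 2 * N%:R / e :> K by rewrite divr_ge0 ?mulr_ge0 ?ler0n // ltW.
(* This [k] keeps the linear term below [e * m / 2]; the threshold on [m] chosen below does the same
   for the constant [C]. *)
pose k := Num.bound (2 * N%:R / e : K).
have [C PC] := bound k.
have C0 : 0 <= 2 * C%:R / e :> K by rewrite divr_ge0 ?mulr_ge0 ?ler0n // ltW.
exists (Num.bound (2 * C%:R / e : K)).+1 => // m /= Mm.
have m0 : 0 < m%:R :> K by rewrite ltr0n; apply: leq_trans Mm.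
rewrite sub0r normrN ger0_norm ?divr_ge0 ?ler0n // ler_pdivrMr // mxpowE.
have mC : 2 * C%:R <= e * m%:R.
  rewrite [e * _]mulrC -ler_pdivrMr //; apply: ltW; apply: lt_trans (archi_boundP C0) _.
  by rewrite ltr_nat.
have kN : 2 * N%:R <= e * k.+1%:R.
  rewrite [e * _]mulrC -ler_pdivrMr //; apply: ltW; apply: lt_trans (archi_boundP N0) _.
  by rewrite ltr_nat.
have q : (m %/ k.+1)%:R * k.+1%:R <= m%:R :> K by rewrite -natrM ler_nat leq_trunc_div.
have q0 : 0 <= (m %/ k.+1)%:R :> K by rewrite ler0n.
have : (cl (g ^+ m))%:R <= N%:R * (m %/ k.+1)%:R + C%:R :> K.
  by rewrite -natrM -natrD ler_nat.
set x := _%:R in q q0 *; move=> h.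
have : 2 * N%:R * x <= e * k.+1%:R * x by rewrite ler_wpM2r.
have : e * (x * k.+1%:R) <= e * m%:R by rewrite ler_wpM2l // ltW.
lra.
Qed.

Theorem theorem1p4 (R : idomainType) (n : nat) (K : realType) :
  euclidean_ring R -> (6 <= n)%N ->
  (forall psi : 'M[R]_n -> K, quasi_hom_SL psi -> bounded_on_SL psi) /\
  (forall g : 'M[R]_n, in_comm_subgroup g -> scl_zero K g).
Proof.
move=> eR n6; have -> : n = (4 + (n - 4))%N by lia.
have [N NP] := SL_powers_bound (n - 4) eR; split.
  move=> psi [D psiD]; exists (D + 8 * D * N%:R + 1) => g sg.
  by apply: (quasi_hom_bound (n := 3 + (n - 4)) psiD sg); apply: NP.
move=> g [k gk]; apply: (powers_bound_scl0 (n := 3 + (n - 4)) NP).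
exact: prod_comm_inSL gk.
Qed.
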